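(* Let $n\geq 2$ be an integer, let $S\subseteq\{1,\dots,\lfloor n/2\rfloor\}$, and let $G=\mathrm{Circ}(n,S)$. If $G$ is a nut graph, then there is an integer $t>0$ such that the set $S$ consists of exactly $t$ odd and exactly $t$ even integers from $\{1,\dots,n/2-1\}$. Consequently, $G$ is $4t$-regular.
   Context: For $n\in\mathbb{N}$ and a generator set $S\subseteq\{1,\dots,\lfloor n/2\rfloor\}$, $\mathrm{Circ}(n,S)$ denotes the circulant graph with vertex set $V=\{0,1,\dots,n-1\}$ in which $i$ is adjacent to $i\pm s$ (computed modulo $n$) for every $i\in V$ and $s\in S$. A simple graph with at least two vertices is a nut graph if its adjacency matrix has the eigenvalue $0$ with multiplicity exactly $1$ and an eigenvector corresponding to $0$ has no zero entries. *)

(* Defs.v *)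
From mathcomp Require Import all_boot all_order all_algebra.
From mathcomp Require Import reals.
Set Implicit Arguments.
Unset Strict Implicit.
Unset Printing Implicit Defensive.
Import GRing.Theory.

(* A graph on the vertex set {0, ..., n-1} is a [rel 'I_n]. *)

Definition simple_graph (n : nat) (e : rel 'I_n) : Prop :=
  symmetric e /\ irreflexive e.

Definition adj_matrix (R : realType) (n : nat) (e : rel 'I_n) : 'M[R]_n :=
  (\matrix_(i, j) (e i j)%:R)%R.

(* The multiplicity is the algebraic one. Eigenvectors are row vectors, as
   always with [eigenspace]; this is harmless since the matrix is symmetric. *)
Definition nut_graph (R : realType) (n : nat) (e : rel 'I_n) : Prop :=
  [/\ 2 <= n,
      simple_graph e,
      mup 0%R (char_poly (adj_matrix R e)) = 1
    & exists v : 'rV[R]_n,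
        [/\ (v <= eigenspace (adj_matrix R e) 0)%MS, v <> 0%R
          & forall i, v ord0 i <> 0%R]].

(* Generators are elements of 'I_n, which loses nothing: n./2 < n when 0 < n.
   The second disjunct says j = i - s modulo n without truncated subtraction. *)
Definition circ (n : nat) (S : {set 'I_n}) : rel 'I_n :=
  fun i j => [exists s in S, (j == i + s %[mod n]) || (j + s == i %[mod n])].

Definition regular_graph (n : nat) (e : rel 'I_n) (d : nat) : Prop :=
  forall i : 'I_n, #|[set j | e i j]| = d.

Lemma circ_simple (n : nat) (S : {set 'I_n}) :
  (forall s : 'I_n, s \in S -> 1 <= s <= n./2) -> simple_graph (circ S).
Proof.
move=> hS; split=> [i j | i].
  by apply: eq_existsb => s; rewrite orbC eq_sym [X in _ || X]eq_sym.
apply/existsP=> -[s /andP[/hS /andP[s_gt0 _]]].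
have /negP nd : ~~ (n %| s) by rewrite gtnNdvd.
by rewrite eq_sym orbb -{2}[i : nat]addn0 eqn_modDl mod0n => /nd.
Qed.

(* Main.v *)
(* The kernel of the adjacency matrix is invariant under the rotation
   i |-> i + 1 of Z/n. When it is a line spanned by v, rotation acts on v by a
   real scalar c with c ^ n = 1, so v is constant or alternating. A constant v
   forces the common degree to be 0, hence a zero matrix. So n is even, v
   alternates, and every vertex has as many even as odd neighbours. The
   neighbourhood of 0 is S :|: -S, where S and -S have the same parities and
   meet at most in n / 2; a parity count shows that they are disjoint. *)
Require Import Defs.
From mathcomp Require Import all_boot all_order all_algebra.
From mathcomp Require Import reals zify.
Set Implicit Arguments.
Unset Strict Implicit.
Unset Printing Implicit Defensive.
Import GRing.Theory Num.Theory.

Section CharPoly.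
Local Open Scope ring_scope.

(* For an invertible Q such that Q *m A has only its first \rank A rows
   nonzero, the other rows of Q *m ('X - A) are divisible by 'X. *)
Lemma dvdp_char_poly_corank (F : fieldType) n (A : 'M[F]_n) :
  'X^(n - \rank A) %| char_poly A.
Proof.
set r := \rank A; set Q := invmx (col_ebase A).
have QA : Q *m A = pid_mx r *m row_ebase A.
  by rewrite -{1}[A]mulmx_ebase -mulmxA mulKmx ?col_ebase_unit.
pose d : 'rV[{poly F}]_n := \row_i (if (i < r)%N then 1 else 'X).
pose QX := map_mx polyC Q *m char_poly_mx A.
pose M := \matrix_(i, j) (if (i < r)%N then QX i j else (Q i j)%:P).
have QXE : QX = diag_mx d *m M.
  apply/matrixP=> i j; rewrite mul_diag_mx.
  rewrite [RHS]mxE [X in X * _]mxE [X in _ * X]mxE.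
  case: ltnP => [_ | le_ri]; first by rewrite mul1r.
  have QA0 : (Q *m A) i j = 0.
    rewrite QA mxE big1 // => k _; rewrite mxE [(i < r)%N]ltnNge le_ri andbF.
    by rewrite mul0r.
  rewrite /QX mulmxBr -map_mxM mul_mx_scalar.
  rewrite [LHS]mxE [X in _ + X]mxE [X in - X]mxE.
  by rewrite QA0 rmorph0 subr0 !mxE.
have := congr1 determinant QXE; rewrite !det_mulmx det_map_mx det_diag.
have -> : \prod_i d 0 i = 'X^(n - r).
  transitivity (\prod_(0 <= i < n) (if (i < r)%N then 1 else 'X : {poly F})).
    by rewrite big_mkord; apply: eq_bigr => i _; rewrite mxE.
  rewrite (@big_cat_nat _ _ _ r) ?rank_leq_row //= [X in X * _]big_nat.
  rewrite [X in X * _]big1 ?mul1r => [|i /andP[_ ->]] //.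
  rewrite big_nat (eq_bigr (fun=> 'X)) -?big_nat ?prodr_const_nat // => i.
  by case/andP=> le_ri _; rewrite ltnNge le_ri.
(* The factor [\det Q] is a nonzero constant, so it can be inserted without affecting
   divisibility. *)
move=> detE; rewrite -(@dvdpZr _ (\det Q)).
  by rewrite -mul_polyC detE dvdp_mulr.
by rewrite -unitfE -[_ \is a _]/(Q \in unitmx) unitmx_inv col_ebase_unit.
Qed.
End CharPoly.

(** Geometric multiplicity is at most algebraic multiplicity; this turns the nut condition on
    [char_poly] into a kernel of dimension at most 1. *)
Lemma corank_le_mup (F : fieldType) n (A : 'M[F]_n) :
  n - \rank A <= mup 0%R (char_poly A).
Proof.
rewrite mup_geq ?monic_neq0 ?char_poly_monic // subr0.
exact: dvdp_char_poly_corank.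
Qed.

Section Circulant.
Variables (m : nat) (S : {set 'I_m.+2}).
Local Open Scope ring_scope.

(** The connection set of the circulant as a Cayley graph of Z/n. Writing n as [m.+2] gives the
    ordinals their ring structure. *)
Definition circ_nbr : {set 'I_m.+2} := S :|: [set - s | s in S].

Lemma circE i j : circ S i j = (j - i \in circ_nbr).
Proof.
rewrite inE; apply/existsP/orP => [[s /andP[sS]] | [jiS | /imsetP[s sS ji]]].
- have addE (a b c : 'I_m.+2) :
      ((a + b)%N == c %[mod m.+2])%N = (a + b == c).
    by rewrite -(inj_eq val_inj) /= [(c %% _)%N]modn_small.
  rewrite eq_sym !addE => /orP[/eqP<- | /eqP<-].
    by left; rewrite addrC addKr.
  by right; rewrite opprD addrA subrr add0r imset_f.
- exists (j - i); rewrite jiS /= -[(i + _ %% _)%N]/(i + (j - i)%R)%N.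
  apply/orP; left; rewrite -[X in _ == X]/(val (i + (j - i))).
  by rewrite addrC subrK modn_small.
- exists s; rewrite sS; apply/orP; right.
  rewrite -[X in X == _]/(val (j + s)).
  by rewrite -[j](subrK i) ji addrAC addNr add0r modn_small.
Qed.

Lemma circD k i j : circ S (i + k) (j + k) = circ S i j.
Proof. by rewrite !circE opprD addrACA subrr addr0. Qed.

Lemma circ_regular : regular_graph (circ S) #|circ_nbr|.
Proof.
move=> i; rewrite -[RHS](card_imset _ (addrI i)); apply: eq_card => j.
rewrite inE circE; apply/idP/imsetP => [jiN | [k kN ->]].
  by exists (j - i); rewrite // addrC subrK.
by rewrite addrC addKr.
Qed.

(** Inclusion-exclusion for S and -S: since P is invariant under negation, it selects equally many
    elements of each. *)
Lemma card_circ_nbr (P : pred 'I_m.+2) :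
    (forall i, P (- i) = P i) ->
  (#|[set i in circ_nbr | P i]| + #|[set i in S | (- i \in S) && P i]|
    = 2 * #|[set s in S | P s]|)%N.
Proof.
move=> PN; pose T := [set s in S | P s].
have memN i (B : {set 'I_m.+2}) : (i \in [set - s | s in B]) = (- i \in B).
  by rewrite -{1}[i]opprK mem_imset //; apply: oppr_inj.
rewrite -/T mul2n -addnn -{2}(card_imset T (@oppr_inj _)) -[RHS]cardsUI.
congr (_ + _)%N; apply: eq_card => i; rewrite !inE !memN ?inE ?PN.
  by case: (i \in S); case: (- i \in S); case: (P i).
by case: (i \in S); case: (- i \in S); case: (P i).
Qed.

End Circulant.

(** Translation by 1 is a graph automorphism, so coordinate j of the new product is coordinate j + 1
    of the old one. *)
Lemma kernel_circ_rotation (R : realType) m (S : {set 'I_m.+2})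
    (v : 'rV[R]_m.+2) :
    (v *m adj_matrix R (circ S) = 0)%R ->
  ((\row_i v ord0 (i + 1)) *m adj_matrix R (circ S) = 0)%R.
Proof.
move=> vA; apply/rowP=> j.
have := congr1 (fun u : 'rV_m.+2 => u ord0 (j + 1)%R) vA.
rewrite !mxE; apply: etrans; rewrite [RHS](reindex_inj (addIr 1%R)) /=.
by apply: eq_bigr => i _; rewrite !mxE circD.
Qed.

Lemma corank1_proportional (F : fieldType) n (A : 'M[F]_n) (v w : 'rV[F]_n) :
    n - \rank A <= 1 -> v <> 0%R -> (v *m A = 0)%R -> (w *m A = 0)%R ->
  exists c, (w = c *: v)%R.
Proof.
move=> cork v0 /sub_kermxP vK /sub_kermxP wK; apply/sub_rVP.
apply: submx_trans wK _; rewrite -(geq_leqif (mxrank_leqif_sup vK)).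
by rewrite mxrank_ker rank_rV; move/eqP: v0 => ->.
Qed.

Lemma sum_sign (R : pzRingType) n (N : {set 'I_n}) :
  (\sum_(i in N) (-1) ^+ i = #|[set i in N | ~~ odd i]|%:R
     - #|[set i in N | odd i]|%:R :> R)%R.
Proof.
rewrite (bigID (fun i : 'I_n => odd i)) /= addrC; congr (_ + _)%R.
  rewrite (eq_bigr (fun=> 1%R)) => [|i /andP[_ /negPf ei]]; last first.
    by rewrite -signr_odd ei.
  by rewrite sumr_const cardsE.
rewrite (eq_bigr (fun=> -1%R)%R) => [|i /andP[_ oi]].
  by rewrite sumr_const cardsE mulNrn.
by rewrite -signr_odd oi.
Qed.

Lemma nut_circ_balanced (R : realType) m (S : {set 'I_m.+2}) :
    nut_graph R (circ S) ->
  [/\ ~~ odd m, 0 < #|circ_nbr S|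
    & #|[set i in circ_nbr S | odd i]| = #|[set i in circ_nbr S | ~~ odd i]|].
Proof.
case=> _ [circ_sym _] mup1 [v [/eigenspaceP vA v0 v_neq0]].
rewrite scale0r in vA.
have cork : m.+2 - \rank (adj_matrix R (circ S)) <= 1.
  by rewrite -mup1 corank_le_mup.
(* Without neighbours the matrix would vanish and have corank n, which is at least 2. *)
have nbr_gt0 : 0 < #|circ_nbr S|.
  rewrite lt0n; apply/negP=> /eqP/cards0_eq nbr0; move: cork.
  suff -> : adj_matrix R (circ S) = 0%R by rewrite mxrank0.
  by apply/matrixP=> i j; rewrite !mxE circE nbr0 inE.
have [c vS] := corank1_proportional cork v0 vA (kernel_circ_rotation vA).
have v1 i : v ord0 (i + 1)%R = (c * v ord0 i)%R.
  by have := congr1 (fun u : 'rV_m.+2 => u ord0 i) vS; rewrite !mxE.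
have vX k : v ord0 (k%:R)%R = (c ^+ k * v ord0 0)%R.
  elim: k => [|k IH]; first by rewrite mul1r.
  by rewrite mulrSr v1 IH mulrA exprS.
have vE (i : 'I_m.+2) : v ord0 i = (c ^+ i * v ord0 0)%R.
  by rewrite -vX natr_Zp.
(* After n rotations the index is back at 0, where v does not vanish. *)
have cn1 : (c ^+ m.+2 = 1)%R.
  apply: (mulIf (introN eqP (v_neq0 0%R))); rewrite -vX mul1r.
  by rewrite (@pchar_Zp m.+2).
(* Coordinate 0 of the kernel equation, divided by the nonzero entry of v at 0. *)
have sum0 : (\sum_(i in circ_nbr S) c ^+ i = 0)%R.
  apply: (mulIf (introN eqP (v_neq0 0%R))); rewrite mul0r mulr_suml.
  have := congr1 (fun u : 'rV_m.+2 => u ord0 0%R) vA; rewrite !mxE => sumA.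
  rewrite -[RHS]sumA.
  rewrite big_mkcond; apply: eq_bigr => i _.
  rewrite mxE circ_sym circE subr0 -vE.
  by case: (i \in _); rewrite ?mulr1 ?mulr0.
have : (`|c| == 1)%R by rewrite -(@pexpr_eq1 _ _ m.+2) // -normrX cn1 normr1.
rewrite eqr_norml ler01 andbT => /orP[/eqP c1 | /eqP cN1].
  move: sum0 nbr_gt0; rewrite (eq_bigr (fun=> 1%R)) => [|i _]; last first.
    by rewrite c1 expr1n.
  by rewrite sumr_const => /eqP; rewrite pnatr_eq0 => /eqP->.
rewrite cN1 in cn1 sum0; split=> //.
  move: cn1; rewrite -signr_odd /= negbK; case: (odd m) => // /eqP.
  by rewrite expr1 eq_sym -addr_eq0 (@pnatr_eq0 R 2).
by move: sum0; rewrite sum_sign => /eqP; rewrite subr_eq0 eqr_nat => /eqP.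
Qed.

Theorem lemma4 (R : realType) (n : nat) (hn : 2 <= n) (S : {set 'I_n})
    (hS : forall s : 'I_n, s \in S -> 1 <= s <= n./2)
    (hnut : nut_graph R (circ S)) :
  ~~ odd n /\
  exists t : nat,
    [/\ 0 < t,
        forall s : 'I_n, s \in S -> 1 <= s <= n./2 - 1,
        #|[set s in S | odd s]| = t,
        #|[set s in S | ~~ odd s]| = t
      & regular_graph (circ S) (4 * t)].
Proof.
case: n hn S hS hnut => [|[|m]] // _ S hS hnut.
have [m_even nbr_gt0 bal] := nut_circ_balanced hnut.
have mF : odd m.+2 = false by rewrite /= negbK; apply/negbTE.
split; first by rewrite mF.
have oddN (i : 'I_m.+2) : odd (- i)%R = odd i.
  rewrite /= odd_mod // oddB ?mF //; exact/ltnW/ltn_ord.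
(* Both i and n - i are at most n / 2. *)
have midS (i : 'I_m.+2) : i \in S -> (- i)%R \in S -> i = m.+2./2 :> nat.
  move=> /hS i_le /hS; have lt_i := ltn_ord i.
  by rewrite /= modn_small; lia.
have card_mid : #|[set i in S | (- i)%R \in S]| <= 1.
  apply/card_le1_eqP=> i j; rewrite !inE => /andP[iS iN] /andP[jS jN].
  by apply: val_inj; rewrite /= (midS i) // (midS j).
have card_split (P : pred 'I_m.+2) (A : {set 'I_m.+2}) :
    #|[set i in A | P i]| + #|[set i in A | ~~ P i]| = #|A|.
  rewrite -(cardsID [set i | P i] A); congr (_ + _).
    by apply: eq_card => i; rewrite !inE.
  by apply: eq_card => i; rewrite !inE andbC.
have evenN (i : 'I_m.+2) : ~~ odd (- i)%R = ~~ odd i by rewrite oddN.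
have ev := @card_circ_nbr m S (fun i => ~~ odd i) evenN.
have od := @card_circ_nbr m S (fun i => odd i) oddN.
have midE (P : pred 'I_m.+2) :
    #|[set i in S | (- i)%R \in S & P i]|
      = #|[set i in [set i in S | (- i)%R \in S] | P i]|.
  by apply: eq_card => i; rewrite !inE andbA.
rewrite !midE in ev od.
have mid_split := card_split (fun i => odd i) [set i in S | (- i)%R \in S].
have nbr_split := card_split (fun i => odd i) (circ_nbr S).
(* By [ev], [od] and [bal], the odd and even parts of this set have sizes of equal parity, so its
   cardinality is even; it is also at most 1. *)
have mid0 : #|[set i in S | (- i)%R \in S]| = 0 by lia.
exists #|[set s in S | odd s]|; split=> //; try lia.
  move=> s sS; have /andP[s_gt0 s_le] := hS s sS.
  have sN : (- s)%R != s.
    apply/eqP=> sE; have := cards0_eq mid0 => /setP/(_ s).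
    by rewrite !inE sE sS.
  suff : s != m.+2./2 :> nat by lia.
  (* As n is even, n / 2 is its own opposite modulo n. *)
  apply: contraNneq sN => sE; apply/eqP/val_inj; rewrite /= modn_small; lia.
have -> : 4 * #|[set s in S | odd s]| = #|circ_nbr S| by lia.
exact: circ_regular.
Qed.
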